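(* Consider a two-player constant-sum Bayesian game with type-independent payoffs (as specified in the context), with type distribution $F$ on $S_A\times S_B$. Assume that for each $i\in\{A,B\}$ and every bounded measurable function $g:S_{-i}\to\mathbb{R}$, $$\mathbb{E}[g(s_{-i})\mid s_i]=0 \text{ for } F_i\text{-a.e. } s_i\in S_i \implies F\big(g(s_{-i})=0\mid s_i\big)=1 \text{ for } F_i\text{-a.e. } s_i\in S_i .$$ Then every equilibrium $\sigma^*=(\sigma_A^*,\sigma_B^* )$ in which at least one of the strategies $\sigma_A^*,\sigma_B^*$ is identifiable is an ex-post equilibrium, i.e., for each $i\in\{A,B\}$, $u_i(x_i,x_{-i})=U_i^*$ for almost every pair $(x_A,x_B)$ with respect to the joint distribution of actions induced by $(\sigma^*,F)$, where $(U_A^*,U_B^* )$ is the players' (equilibrium-independent) equilibrium payoff vector.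
   Context: Game: there are two players $A,B$; $-i$ denotes the player other than $i$. Player $i$ has a private type $s_i\in S_i$, with $S_i$ a nonempty standard Borel space (equipped with a compatible Polish topology). The profile $(s_A,s_B)$ is drawn from a common-prior probability measure $F$ on $S_A\times S_B$ whose marginals $F_A,F_B$ have supports $S_A,S_B$; $F$ is absolutely continuous with respect to $F_A\otimes F_B$. $F(\cdot\mid s_i)$ denotes the regular conditional distribution of $s_{-i}$ given $s_i$. After learning their types, players simultaneously choose actions $x_i\in X_i$, where $X_i$ is a nonempty standard Borel space. Payoffs $u_i(x_i,x_{-i})$ are measurable, uniformly bounded, do not depend on types, and satisfy $u_A+u_B=0$ at every action profile. Payoffs are extended linearly to mixed actions in $\Delta(X_A)\times\Delta(X_B)$. A (mixed) strategy of player $i$ is a measurable map $\sigma_i:S_i\to\Delta(X_i)$. An equilibrium is a Bayes-Nash equilibrium: $(\sigma_A^*,\sigma_B^* )$ such that for each $i$ and $F_i$-a.e. $s_i$, $\sigma_i^*(\cdot\mid s_i)$ maximizes player $i$'s conditional expected payoff given $s_i$ against $\sigma_{-i}^*$. All equilibria yield the same ex-ante payoff vector, denoted $(U_A^*,U_B^* )$. Identifiable strategy: $\sigma_i$ is identifiable if for every bounded measurable $g:X_i\to\mathbb{R}$, [$\mathbb{E}[g(x_i)\mid s_i]=0$ for $F_i$-a.e. $s_i$] implies [$\Pr(g(x_i)=0\mid s_i)=1$ for $F_i$-a.e. $s_i$], where expectation and probability are taken under $x_i\sim\sigma_i(\cdot\mid s_i)$. *)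

(* Defs.v *)
From HB Require Import structures.
From mathcomp Require Import all_boot all_order all_algebra.
From mathcomp Require Import all_classical all_reals all_analysis.

Set Implicit Arguments.
Unset Strict Implicit.
Unset Printing Implicit Defensive.

Import Order.TTheory GRing.Theory Num.Theory.
Import numFieldNormedType.Exports.

Local Open Scope classical_set_scope.
Local Open Scope ring_scope.

Notation borel T := (g_sigma_algebraType (@open T)).

(* A Hausdorff pseudometric space is metrizable, so this says that the topology
   of [T] is Polish. *)
Definition polish (R : realType) (T : completePseudoMetricType R) : Prop :=
  hausdorff_space T /\ exists2 D : set T, countable D & dense D.

Definition standard_borel (R : realType) d (X : measurableType d) : Prop :=
  exists (P : completePseudoMetricType R) (f : X -> borel P) (g : borel P -> X),
    [/\ polish P, measurable_fun setT f, measurable_fun setT g,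
        cancel f g & cancel g f].

Definition msupport (R : realType) (T : topologicalType)
    (mu : set T -> \bar R) : set T :=
  [set x | forall U, open_nbhs x U -> (0 < mu U)%E].

(* The two players are the booleans: A is [true], B is [false], and the
   opponent of [i] is [~~ i].  A profile is the pair of its A-component and its
   B-component, in this order. *)
Definition coord (T : bool -> Type) (i : bool) (z : T true * T false) : T i :=
  if i as j return T j then z.1 else z.2.
Arguments coord T i z : clear implicits.

Section types.
Context {R : realType} (S : bool -> completePseudoMetricType R).

Definition type_coord (i : bool) :
    borel (S true) * borel (S false) -> borel (S i) :=
  coord (fun j => borel (S j)) i.

Lemma measurable_type_coord i : measurable_fun setT (type_coord i).
Proof. by case: i; [exact: measurable_fst|exact: measurable_snd]. Qed.

HB.instance Definition _ i :=
  isMeasurableFun.Build _ _ _ _ (type_coord i) (@measurable_type_coord i).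

Definition type_marginal
    (F : probability (borel (S true) * borel (S false))%type R) (i : bool) :
    probability (borel (S i)) R :=
  distribution F (type_coord i).

End types.
Arguments type_coord {R} S i _.

(* [types_of G i] carries a complete metric only as a witness that its topology
   is Polish.  [payoff G i a b] is the payoff of player [i] when [i] plays [a]
   and the opponent plays [b].  [cond G i] is a version of the regular
   conditional distribution of the opponent's type given that of [i]; it is
   determined by the prior up to a null set of types of [i].  Type and action
   spaces are nonempty because the library structures are pointed. *)
Record bayesian_game (R : realType) := BayesianGame {
  types_of : bool -> completePseudoMetricType R ;
  types_polish : forall i, polish (types_of i) ;
  action_disp : bool -> measure_display ;
  actions_of : forall i, measurableType (action_disp i) ;
  actions_standard_borel : forall i, standard_borel R (actions_of i) ;
  prior : probability (borel (types_of true) * borel (types_of false))%type R ;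
  full_support : forall i,
    msupport (type_marginal prior i) = [set: types_of i] ;
  prior_ac :
    prior `<< (type_marginal prior true \x type_marginal prior false)%E ;
  cond : forall i, R.-pker borel (types_of i) ~> borel (types_of (~~ i)) ;
  condE : forall i (C : set (borel (types_of i)))
      (D : set (borel (types_of (~~ i)))), measurable C -> measurable D ->
    prior [set s | C (type_coord types_of i s) /\
                   D (type_coord types_of (~~ i) s)] =
    (\int[type_marginal prior i]_(t in C) cond i t D)%E ;
  payoff : forall i, actions_of i -> actions_of (~~ i) -> R ;
  payoff_measurable : forall i,
    measurable_fun setT (fun z : actions_of i * actions_of (~~ i) =>
                           payoff z.1 z.2) ;
  payoff_bounded : exists M : R, forall i a b, `|@payoff i a b| <= M ;
  payoff_zero_sum : forall (a : actions_of true) (b : actions_of false),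
    @payoff true a b + @payoff false b a = 0
}.

Arguments payoff {R} G i _ _ : rename.

(* For [k] the conditional distribution of the opponent's type this is the
   assumption on the prior; for [k] a strategy it is identifiability. *)
Definition bounded_complete (R : realType) d d' (T : measurableType d)
    (T' : measurableType d') (mu : {measure set T -> \bar R}) (k : R.-pker T ~> T') :
    Prop :=
  forall g : T' -> R, measurable_fun setT g ->
    (exists M : R, forall y, `|g y| <= M) ->
    (\forall s \ae mu, \int[k s]_y g y = 0) ->
    \forall s \ae mu, k s [set y | g y = 0] = 1%E.

Section equilibrium.
Context {R : realType} (G : bayesian_game R).

Definition marginal (i : bool) : probability (borel (types_of G i)) R :=
  type_marginal (prior G) i.

Definition action_coord (i : bool) :=
  coord (fun j => actions_of G j) i.

Definition strategy (i : bool) :=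
  R.-pker borel (types_of G i) ~> actions_of G i.

Definition strategy_profile := forall i, strategy i.

Implicit Types sigma : strategy_profile.

Definition identifiable (i : bool) (s : strategy i) : Prop :=
  bounded_complete (marginal i) s.

Definition mixed_payoff (i : bool)
    (mu : {measure set (actions_of G i) -> \bar R})
    (nu : {measure set (actions_of G (~~ i)) -> \bar R}) : R :=
  \int[mu]_a \int[nu]_b payoff G i a b.

Definition interim_payoff (i : bool) (t : types_of G i)
    (mu : {measure set (actions_of G i) -> \bar R})
    (tau : strategy (~~ i)) : R :=
  \int[cond G i t]_t' mixed_payoff mu (tau t').

Definition bayes_nash sigma : Prop :=
  forall i, \forall t \ae marginal i,
    forall mu : probability (actions_of G i) R,
      interim_payoff t mu (sigma (~~ i)) <=
      interim_payoff t (sigma i t) (sigma (~~ i)).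

Definition ex_ante_payoff sigma (i : bool) : R :=
  \int[prior G]_s mixed_payoff (sigma i (type_coord (types_of G) i s))
                               (sigma (~~ i) (type_coord (types_of G) (~~ i) s)).

(* All equilibria have the same ex-ante payoffs, so at most one [U] qualifies. *)
Definition equilibrium_payoff (U : bool -> R) : Prop :=
  exists2 tau, bayes_nash tau & ex_ante_payoff tau =1 U.

(* Conditionally on the type profile, the players randomize independently. *)
Definition action_law sigma :
    set (actions_of G true * actions_of G false) -> \bar R :=
  fun E => (\int[prior G]_s (sigma true s.1 \x sigma false s.2) E)%E.

Definition ex_post sigma (U : bool -> R) : Prop :=
  forall i, \forall x \ae action_law sigma,
    payoff G i (action_coord i x) (action_coord (~~ i) x) = U i.

End equilibrium.

(* Main.v *)
(* For types a of A and b of B, let J(a, b) be the payoff of A when A's type a'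
   is drawn from the beliefs of b and, independently, B's type b' from those of
   a, both then playing the equilibrium.  Averaging the deviations sigma_A(a')
   of a and sigma_B(b') of b gives - V_B(b) <= J(a, b) <= V_A(a) for the interim
   values V_A, V_B.  Their means are opposite, so V_A, - V_B and J all equal the
   value v almost everywhere for the product of the marginals; with two
   different equilibria the same bound shows that v is common to both.

   Completeness on B's side strips the beliefs of b from J = v: type a gets v
   against sigma_B by playing as almost any other type a'.  No action gives a
   more than v, so almost every action x of a' gives a exactly v.  Completeness
   on A's side then yields u(x, sigma_B(b')) = v for almost every b', and
   identifiability of sigma_B yields u(x, y) = v for almost every y.  All draws
   so far are independent across players; absolute continuity of F carries
   the null set over to the actual type distribution. *)
Require Import Defs.
From HB Require Import structures.
From mathcomp Require Import all_boot all_order all_algebra.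
From mathcomp Require Import all_classical all_reals all_analysis.
From mathcomp Require Import measurable_realfun lra.

Set Implicit Arguments.
Unset Strict Implicit.
Unset Printing Implicit Defensive.

Import Order.TTheory GRing.Theory Num.Theory.
Import numFieldNormedType.Exports.

Local Open Scope classical_set_scope.
Local Open Scope ring_scope.

(** * Integrals of bounded measurable functions *)

(** Values of a kernel are plain measures of mass one. [mnormalize] carries the probability
    structure and leaves such a measure unchanged, so facts about probabilities transfer to them. *)
Lemma probability_ind (R : realType) d (T : measurableType d)
    (Q : {measure set T -> \bar R} -> Prop) :
  (forall P : probability T R, Q P) ->
  forall mu : {measure set T -> \bar R}, mu setT = 1%E -> Q mu.
Proof.
move=> QP mu mu1.
have E : mnormalize mu (dirac point) = mu :> (set T -> \bar R).
  by apply/funext => A; rewrite /mnormalize mu1 onee_eq0/= invr1 mule1.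
by rewrite -(eq_measure E); exact: QP.
Qed.

(** The bound is pointwise and refers to no measure: the class is stable under measurable
    substitution, and its members are integrable for all values of a kernel at once. *)
Definition bounded_mfun (R : realType) d (T : measurableType d) (f : T -> R) :=
  measurable_fun setT f /\ exists M : R, forall x, `|f x| <= M.

Section bounded_mfun.
Context {R : realType} {d} {T : measurableType d}.
Implicit Types f g : T -> R.

Lemma bounded_mfun_cst c : bounded_mfun (cst c : T -> R).
Proof. by split; [exact: measurable_cst|exists `|c|]. Qed.

Lemma bounded_mfunN f : bounded_mfun f -> bounded_mfun (fun x => - f x).
Proof.
move=> [mf [M fM]]; split; first exact: measurableT_comp mf.
by exists M => x; rewrite normrN.
Qed.

Lemma bounded_mfunD f g :
  bounded_mfun f -> bounded_mfun g -> bounded_mfun (fun x => f x + g x).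
Proof.
move=> [mf [M fM]] [mg [N gN]]; split; first exact: measurable_funD.
by exists (M + N) => x; rewrite (le_trans (ler_normD _ _))// lerD.
Qed.

Lemma bounded_mfunB f g :
  bounded_mfun f -> bounded_mfun g -> bounded_mfun (fun x => f x - g x).
Proof. by move=> bf bg; apply: bounded_mfunD => //; exact: bounded_mfunN. Qed.

Lemma bounded_mfun_comp d' (T' : measurableType d') (h : T' -> T) f :
  measurable_fun setT h -> bounded_mfun f -> bounded_mfun (fun x => f (h x)).
Proof.
move=> mh [mf [M fM]]; split; first exact: measurableT_comp mf mh.
by exists M.
Qed.

Lemma bounded_mfun_indic (A : set T) : measurable A -> bounded_mfun (\1_A : T -> R).
Proof.
move=> mA; split; first exact: measurable_indic.
by exists 1 => x; rewrite indicE; case: (_ \in _); rewrite ?normr1 ?normr0.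
Qed.

End bounded_mfun.

Section bounded_Rintegral.
Context {R : realType} {d} {T : measurableType d}.
Context (mu : {measure set T -> \bar R}) (mu1 : mu setT = 1%E).
Implicit Types f g : T -> R.

Lemma bounded_mfun_integrable f :
  bounded_mfun f -> mu.-integrable setT (EFin \o f).
Proof.
move=> [mf [M fM]]; apply: measurable_bounded_integrable => //.
  by rewrite mu1 ltry.
exists M; split; rewrite ?num_real// => x Mx y _ /=.
by rewrite (le_trans (fM y))// ltW.
Qed.

Lemma RintegralT_cst (c : R) : \int[mu]_x c = c.
Proof. by rewrite Rintegral_cst// mu1 mulr1. Qed.

Lemma bounded_RintegralD f g : bounded_mfun f -> bounded_mfun g ->
  \int[mu]_x (f x + g x) = \int[mu]_x f x + \int[mu]_x g x.
Proof. by move=> bf bg; rewrite RintegralD//; exact: bounded_mfun_integrable. Qed.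

Lemma bounded_RintegralB f g : bounded_mfun f -> bounded_mfun g ->
  \int[mu]_x (f x - g x) = \int[mu]_x f x - \int[mu]_x g x.
Proof. by move=> bf bg; rewrite RintegralB//; exact: bounded_mfun_integrable. Qed.

Lemma bounded_RintegralN f : bounded_mfun f ->
  \int[mu]_x (- f x) = - \int[mu]_x f x.
Proof.
move=> bf; have := bounded_RintegralB (bounded_mfun_cst 0) bf.
by rewrite /cst RintegralT_cst sub0r => <-; apply: eq_Rintegral => x _; rewrite sub0r.
Qed.

Lemma EFin_bounded_Rintegral f : bounded_mfun f ->
  (\int[mu]_x f x)%:E = (\int[mu]_x (f x)%:E)%E.
Proof.
by move=> bf; rewrite fineK//; apply: integrable_fin_num => //;
  exact: bounded_mfun_integrable.
Qed.

Lemma ae_eq_Rintegral f g : bounded_mfun f -> bounded_mfun g ->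
  (\forall x \ae mu, f x = g x) -> \int[mu]_x f x = \int[mu]_x g x.
Proof.
move=> [mf _] [mg _] fg; congr fine; apply: ae_eq_integral => //.
- exact/measurable_EFinP.
- exact/measurable_EFinP.
- by apply: filterS fg => x /= -> .
Qed.

(** The maximum of [f] and [g] agrees with [g] almost everywhere and dominates [f] everywhere, which
    reduces to pointwise monotonicity. *)
Lemma ae_le_Rintegral f g : bounded_mfun f -> bounded_mfun g ->
  (\forall x \ae mu, f x <= g x) -> \int[mu]_x f x <= \int[mu]_x g x.
Proof.
move=> bf bg fg; have bm : bounded_mfun (fun x => Num.max (f x) (g x)).
  split; first by apply: measurable_maxr; [exact: bf.1|exact: bg.1].
  have [[_ [M fM]] [_ [N gN]]] := (bf, bg).
  exists (Num.max M N) => x; rewrite le_max.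
  by case: (leP (f x) (g x)) => _; rewrite ?fM ?gN ?orbT.
rewrite [leRHS](@ae_eq_Rintegral _ _ bg bm); last first.
  by apply: filterS fg => x /max_idPr.
apply: le_Rintegral => //; try exact: bounded_mfun_integrable.
by move=> x _; rewrite le_max lexx.
Qed.

Lemma Rintegral_eq0_ae f : bounded_mfun f -> (forall x, 0 <= f x) ->
  \int[mu]_x f x = 0 -> \forall x \ae mu, f x = 0.
Proof.
move=> bf f0 If0.
have /(ae_eq_integral_abs mu) : measurable_fun setT (EFin \o f).
  by apply/measurable_EFinP; exact: bf.1.
move=> /(_ measurableT)[+ _].
under eq_integral do rewrite /= ger0_norm//.
rewrite -EFin_bounded_Rintegral// If0 => /(_ erefl).
by apply: filterS => x /= /(_ I) [].
Qed.

(** The positive part of [g - f] is nonnegative everywhere with integral zero. This is how a bound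
    on payoffs that is tight on average becomes an equality. *)
Lemma ae_eq_of_ae_le f g : bounded_mfun f -> bounded_mfun g ->
  (\forall x \ae mu, f x <= g x) -> \int[mu]_x f x = \int[mu]_x g x ->
  \forall x \ae mu, f x = g x.
Proof.
move=> bf bg fg Ifg; pose h x := Num.max 0 (g x - f x).
have bh : bounded_mfun h.
  have [mD [M DM]] := bounded_mfunB bg bf.
  split; first by apply: measurable_maxr.
  exists M => x; rewrite /h; case: (leP 0 (g x - f x)) => _ //.
  by rewrite normr0 (le_trans _ (DM x)).
have : \int[mu]_x h x = 0.
  rewrite (@ae_eq_Rintegral _ (fun x => g x - f x))//; last 2 first.
  - exact: bounded_mfunB.
  - by apply: filterS fg => x fgx; rewrite /h max_r// subr_ge0.
  by rewrite bounded_RintegralB// Ifg subrr.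
move=> /(Rintegral_eq0_ae bh); have h_ge0 x : 0 <= h x by rewrite le_max lexx.
move=> /(_ h_ge0); apply: filterS2 fg => x fgx; rewrite /h max_r ?subr_ge0// => /eqP.
by rewrite subr_eq0 => /eqP.
Qed.

End bounded_Rintegral.

Lemma bounded_Fubini (R : realType) d d' (T : measurableType d)
    (T' : measurableType d') (mu : {measure set T -> \bar R})
    (nu : {measure set T' -> \bar R}) (f : T -> T' -> R) :
  mu setT = 1%E -> nu setT = 1%E -> bounded_mfun (fun z => f z.1 z.2) ->
  \int[mu]_x \int[nu]_y f x y = \int[nu]_y \int[mu]_x f x y.
Proof.
move=> mu1 nu1 bf; move: mu mu1; apply: probability_ind => P.
move: nu nu1; apply: probability_ind => Q.
have bf1 x : bounded_mfun (f x).
  exact: (bounded_mfun_comp (pair1_measurable x) bf).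
have bf2 y : bounded_mfun (f ^~ y).
  exact: (bounded_mfun_comp (pair2_measurable y) bf).
congr fine.
transitivity (\int[P]_x \int[Q]_y (f x y)%:E)%E.
  by apply: eq_integral => x _; rewrite (EFin_bounded_Rintegral _ (bf1 x)); last exact: probability_setT.
transitivity (\int[Q]_y \int[P]_x (f x y)%:E)%E; last first.
  by apply: eq_integral => y _; rewrite (EFin_bounded_Rintegral _ (bf2 y)); last exact: probability_setT.
apply: (@Fubini _ _ _ _ _ P Q (fun z => (f z.1 z.2)%:E)).
apply: bounded_mfun_integrable => //.
exact: probability_setT.
Qed.

(** * Kernels and integrals depending on a parameter *)

Section kernel_comap.
Context {R : realType} {d d1 d2} {Z : measurableType d} {T : measurableType d1}
  {T' : measurableType d2}.
Variables (k : R.-pker T ~> T') (h : Z -> T).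

(** Taking the measurability proof as an argument lets the kernel instances below be inferred from
    the term alone. *)
Definition kernel_comap of measurable_fun setT h :
  Z -> {measure set T' -> \bar R} := fun z => k (h z).

Hypothesis mh : measurable_fun setT h.

Let measurable_kernel_comap U : measurable U ->
  measurable_fun setT (kernel_comap mh ^~ U).
Proof. by move=> mU; exact: measurableT_comp (measurable_kernel k U mU) mh. Qed.

HB.instance Definition _ :=
  isKernel.Build _ _ Z T' R (kernel_comap mh) measurable_kernel_comap.

Let prob_kernel_comap z : kernel_comap mh z setT = 1%E.
Proof. exact: prob_kernel. Qed.

HB.instance Definition _ :=
  Kernel_isProbability.Build _ _ Z T' R (kernel_comap mh) prob_kernel_comap.

End kernel_comap.

(** Adding the bound [M] makes the integrand nonnegative, where integration against a kernel is
    measurable in the parameter; by mass one the shift integrates to [M] and is subtracted again.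
    The map [h] lets the integrand depend on more of [z] than the kernel does. *)
Lemma bounded_mfun_Rintegral (R : realType) d d1 d2 (Z : measurableType d)
    (T : measurableType d1) (T' : measurableType d2) (k : R.-pker T ~> T')
    (h : Z -> T) (f : Z -> T' -> R) :
  measurable_fun setT h -> bounded_mfun (fun q => f q.1 q.2) ->
  bounded_mfun (fun z => \int[k (h z)]_y f z y).
Proof.
move=> mh bf; have bf1 z : bounded_mfun (f z).
  exact: (bounded_mfun_comp (pair1_measurable z) bf).
have k1 z : k (h z) setT = 1%E by exact: prob_kernel.
have [mf [M fM]] := bf.
split; last first.
  exists M => z; rewrite ler_norml; apply/andP; split.
    rewrite -[leLHS](RintegralT_cst (k1 z)).
    apply: ae_le_Rintegral => //; first exact: (bounded_mfun_cst (- M)).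
    by apply: aeW => y; have := fM (z, y); rewrite ler_norml => /andP[].
  rewrite -[leRHS](RintegralT_cst (k1 z)).
  apply: ae_le_Rintegral => //; first exact: (bounded_mfun_cst M).
  by apply: aeW => y; have := fM (z, y); rewrite ler_norml => /andP[].
have -> : (fun z => \int[k (h z)]_y f z y) =
    fun z => \int[k (h z)]_y (f z y + M) - M.
  apply/funext => z; rewrite bounded_RintegralD//; last exact: (bounded_mfun_cst M).
  by rewrite RintegralT_cst// addrK.
apply: measurable_funB => //; apply: measurableT_comp => //.
apply: (measurable_fun_integral_finite_kernel
  (fun q => (f q.1 q.2 + M)%:E) (kernel_comap k mh)).
  by move=> q; rewrite lee_fin; have := fM q; rewrite ler_norml => /andP[]; lra.
by apply/measurable_EFinP; exact: measurable_funD.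
Qed.

Lemma bounded_mfun_Rintegral_cst (R : realType) d d' (T : measurableType d)
    (T' : measurableType d') (nu : {measure set T' -> \bar R})
    (f : T -> T' -> R) :
  nu setT = 1%E -> bounded_mfun (fun q => f q.1 q.2) ->
  bounded_mfun (fun x => \int[nu]_y f x y).
Proof.
move=> + bf; move: nu; apply: probability_ind => P.
(* A fixed probability is a kernel from the one-point space. *)
pose k : R.-pker unit ~> T' := kprobability (measurable_cst (P : pprobability T' R)).
by have := @bounded_mfun_Rintegral _ _ _ _ _ _ _ k (cst tt) _ (measurable_cst tt) bf.
Qed.

(** The indicator of the exceptional set has iterated integral zero in one order, hence by Fubini in
    the other; being nonnegative, it then vanishes almost everywhere there too. *)
Lemma ae_swap (R : realType) d d' (T : measurableType d)
    (T' : measurableType d') (mu : {measure set T -> \bar R})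
    (nu : {measure set T' -> \bar R}) (P : T -> T' -> Prop) :
  mu setT = 1%E -> nu setT = 1%E -> measurable [set z | P z.1 z.2] ->
  (\forall x \ae mu, \forall y \ae nu, P x y) ->
  \forall y \ae nu, \forall x \ae mu, P x y.
Proof.
move=> mu1 nu1 mP muP; pose A := ~` [set z : T * T' | P z.1 z.2].
pose f x y : R := \1_A (x, y).
have f0P x y : f x y = 0 <-> P x y.
  rewrite /f indicE in_setC; split; last by move=> Pxy; rewrite (mem_set _).
  by case: (boolP (_ \in _)) => [/set_mem//|_ /eqP]; rewrite oner_eq0.
have bf : bounded_mfun (fun z => f z.1 z.2).
  have := @bounded_mfun_indic R _ _ _ (measurableC mP).
  by rewrite (_ : (fun z => f z.1 z.2) = \1_A)//; apply/funext => -[].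
have bf1 x : bounded_mfun (f x) := bounded_mfun_comp (pair1_measurable x) bf.
have bf2 y : bounded_mfun (f ^~ y) := bounded_mfun_comp (pair2_measurable y) bf.
have If0 : \forall x \ae mu, \int[nu]_y f x y = 0.
  apply: filterS muP => x nuP; rewrite -[RHS](RintegralT_cst nu1).
  apply: ae_eq_Rintegral => //; first exact: bounded_mfun_cst.
  by apply: filterS nuP => y /f0P.
have f_ge0 x y : 0 <= f x y by rewrite /f indicE ler0n.
have bI : bounded_mfun (fun x => \int[nu]_y f x y).
  exact: bounded_mfun_Rintegral_cst.
have bJ : bounded_mfun (fun y => \int[mu]_x f x y).
  apply: (bounded_mfun_Rintegral_cst (f := fun y x => f x y)) => //.
  exact: (bounded_mfun_comp (@measurable_swap _ _ _ _) bf).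
have : \int[nu]_y \int[mu]_x f x y = 0.
  rewrite -bounded_Fubini// -[RHS](RintegralT_cst mu1).
  by apply: ae_eq_Rintegral => //; exact: bounded_mfun_cst.
have J_ge0 y : 0 <= \int[mu]_x f x y by exact: Rintegral_ge0.
move=> /(Rintegral_eq0_ae nu1 bJ J_ge0).
apply: filterS => y /(Rintegral_eq0_ae mu1 (bf2 y) (f_ge0 ^~ y)).
by apply: filterS => x /f0P.
Qed.

(** * Disintegration of a joint law *)

(** The hypothesis is the formula on rectangles, which are stable under intersection and generate
    the product, so it determines the law of [(X, Y)]. The formula follows for nonnegative
    functions, then for bounded ones after a shift by the bound. *)
Lemma bounded_disintegration (R : realType) d d1 d2 (S : measurableType d)
    (T : measurableType d1) (T' : measurableType d2) (F : probability S R)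
    (X : S -> T) (Y : S -> T') (m : probability T R) (k : R.-pker T ~> T')
    (f : T -> T' -> R) :
  measurable_fun setT X -> measurable_fun setT Y ->
  (forall C D, measurable C -> measurable D ->
    F [set s | C (X s) /\ D (Y s)] = (\int[m]_(t in C) k t D)%E) ->
  bounded_mfun (fun z => f z.1 z.2) ->
  \int[F]_s f (X s) (Y s) = \int[m]_t \int[k t]_y f t y.
Proof.
move=> mX mY FE bf.
have mXY : measurable_fun setT (fun s => (X s, Y s)).
  exact: measurable_fun_pair.
have msnd : measurable_fun setT (snd : unit * T -> T) by exact: measurable_snd.
(* Composition of kernels integrates intermediate points out; a final Dirac kernel along this map
   keeps [t] next to [y]. *)
have mgraph : measurable_fun setT (fun q : (unit * T) * T' => (q.1.2, q.2)).
  apply: measurable_fun_pair => //; exact: measurableT_comp.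
(* [K tt] is the joint law m(dt) k(t, dy). *)
pose l : R.-pker unit ~> T := kprobability (measurable_cst (m : pprobability T R)).
pose K := (l \; (kernel_comap k msnd \; kdirac mgraph))%E.
have KE g : (forall z, 0 <= g z)%E -> measurable_fun setT g ->
    (\int[K tt]_z g z = \int[m]_t \int[k t]_y g (t, y))%E.
  move=> g0 mg; rewrite [LHS]integral_kcomp//; apply: eq_integral => t _.
  rewrite integral_kcomp//; apply: eq_integral => y _.
  by rewrite integral_dirac//= diracT mul1e.
pose Z : {mfun S >-> (T * T')%type} := mfun_Sub (mem_set mXY).
have FK A : measurable A -> distribution F Z A = K tt A.
  apply: (measure_unique [set C `*` D | C in measurable & D in measurable]
    (fun=> setT)).
  - exact: measurable_prod_measurableType.
  - move=> _ _ [A1 mA1 [B1 mB1 <-]] [A2 mA2 [B2 mB2 <-]].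
    exists (A1 `&` A2); first exact: measurableI.
    by exists (B1 `&` B2); [exact: measurableI|rewrite setXI].
  - by move=> _; exists setT => //; exists setT => //; rewrite setXTT.
  - by rewrite bigcup_const.
  - move=> _ [C mC [D mD <-]]; transitivity (\int[m]_(t in C) k t D)%E.
      by rewrite -FE.
    transitivity (\int[K tt]_z (\1_(C `*` D) z)%:E)%E; last first.
      by rewrite integral_indic ?setIT//; exact: measurableX.
    rewrite KE; last 2 first.
    + by move=> z; rewrite lee_fin indicE ler0n.
    + by apply/measurable_EFinP; apply: measurable_indic; exact: measurableX.
    rewrite integral_mkcond; apply: eq_integral => t _; rewrite patchE.
    case: ifPn => [/set_mem tC|/negP tC].
      rewrite -[D in LHS]setIT -integral_indic//; apply: eq_integral => y _.
      by rewrite !indicE in_setX (mem_set tC).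
    rewrite integral0_eq// => y _; rewrite indicE in_setX.
    by case: (t \in C) tC => // /(_ isT).
  - by move=> _; exact: (le_lt_trans (probability_le1 _ measurableT) (ltry 1)).
have KER g : bounded_mfun g -> (forall z, 0 <= g z) ->
    \int[F]_s g (X s, Y s) = \int[m]_t \int[k t]_y g (t, y).
  move=> bg g0; congr fine.
  have mg : measurable_fun setT (EFin \o g) by apply/measurable_EFinP; exact: bg.1.
  have g0' z : (0 <= (EFin \o g) z)%E by rewrite lee_fin.
  transitivity (\int[distribution F Z]_z (EFin \o g) z)%E.
    by rewrite ge0_integral_distribution.
  rewrite (eq_measure_integral (K tt)); last by move=> A mA _; exact: FK.
  rewrite KE//; apply: eq_integral => t _.
  rewrite EFin_bounded_Rintegral//; first exact: prob_kernel.
  exact: (bounded_mfun_comp (pair1_measurable t) bg).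
have [_ [M fM]] := bf.
have F1 : F setT = 1%E by exact: probability_setT.
have m1 : m setT = 1%E by exact: probability_setT.
have bM d0 (T0 : measurableType d0) : bounded_mfun (cst M : T0 -> R).
  exact: bounded_mfun_cst.
have bfM := bounded_mfunD bf (bM _ _).
have fM0 z : 0 <= f z.1 z.2 + cst M z.
  by have := fM z; rewrite ler_norml /cst => /andP[]; lra.
have := KER _ bfM fM0; rewrite /= bounded_RintegralD//; last first.
  exact: (bounded_mfun_comp mXY bf).
rewrite RintegralT_cst// => E; apply: (addIr M); rewrite E.
transitivity (\int[m]_t (\int[k t]_y f t y + M)).
  apply: eq_Rintegral => t _; have k1 : k t setT = 1%E by exact: prob_kernel.
  rewrite bounded_RintegralD ?RintegralT_cst//.
  exact: (bounded_mfun_comp (pair1_measurable t) bf).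
rewrite bounded_RintegralD ?RintegralT_cst//.
exact: (@bounded_mfun_Rintegral _ _ _ _ _ _ _ k id _ (@measurable_id _ _ _) bf).
Qed.

(** * Zero-sum interaction of two kernels *)

(** The formula of [mixed_payoff] over arbitrary action spaces instead of spaces indexed by a
    boolean: exchanging the players becomes a renaming, and [u] need not be a payoff of the game. *)
Definition expected_payoff (R : realType) d d' (X : measurableType d)
    (X' : measurableType d') (u : X -> X' -> R) (mu : {measure set X -> \bar R})
    (nu : {measure set X' -> \bar R}) : R :=
  \int[mu]_x \int[nu]_y u x y.

Section best_reply.
Context {R : realType} {d1 d2 e1 e2} {T1 : measurableType d1}
  {T2 : measurableType d2} {X1 : measurableType e1} {X2 : measurableType e2}.
Lemma bounded_expected_payoff (u : X1 -> X2 -> R) (s1 : R.-pker T1 ~> X1)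
    (s2 : R.-pker T2 ~> X2) d (Z : measurableType d) (h1 : Z -> T1)
    (h2 : Z -> T2) :
  bounded_mfun (fun q => u q.1 q.2) ->
  measurable_fun setT h1 -> measurable_fun setT h2 ->
  bounded_mfun (fun z => expected_payoff u (s1 (h1 z)) (s2 (h2 z))).
Proof.
move=> bu mh1 mh2.
apply: (@bounded_mfun_Rintegral _ _ _ _ _ _ _ s1 h1
  (fun z x => \int[s2 (h2 z)]_y u x y)) => //=.
have mh : measurable_fun setT (fun q : Z * X1 => h2 q.1).
  exact: measurableT_comp mh2 measurable_fst.
apply: (@bounded_mfun_Rintegral _ _ _ _ _ _ _ s2 _
  (fun (q : Z * X1) y => u q.2 y) mh) => /=.
apply: (bounded_mfun_comp _ bu (h := fun q : Z * X1 * X2 => (q.1.2, q.2))).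
apply: measurable_fun_pair => //.
exact: measurableT_comp measurable_snd measurable_fst.
Qed.

Variables (m : probability T1 R) (u : X1 -> X2 -> R) (k : R.-pker T1 ~> T2)
  (s1 : R.-pker T1 ~> X1) (s2 : R.-pker T2 ~> X2).

Definition interim_value (a : T1) : R :=
  \int[k a]_b expected_payoff u (s1 a) (s2 b).

Definition best_reply :=
  \forall a \ae m, forall mu : probability X1 R,
    \int[k a]_b expected_payoff u mu (s2 b) <= interim_value a.

Hypothesis bu : bounded_mfun (fun q => u q.1 q.2).

Lemma bounded_interim_value : bounded_mfun interim_value.
Proof.
apply: (@bounded_mfun_Rintegral _ _ _ _ _ _ _ k id
  (fun a b => expected_payoff u (s1 a) (s2 b)) (@measurable_id _ _ _)).
exact: bounded_expected_payoff.
Qed.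

(** Each [t1 a'] is one mixed deviation of type [a], and the bound does not depend on [a'], so it
    survives averaging over [k2 b]. *)
Lemma best_reply_mean (k2 : R.-pker T2 ~> T1) : best_reply ->
  \forall a \ae m, forall b (t1 : R.-pker T1 ~> X1),
    \int[k2 b]_a' \int[k a]_b' expected_payoff u (t1 a') (s2 b') <=
    interim_value a.
Proof.
apply: filterS => a br b t1.
have k2b : k2 b setT = 1%E by exact: prob_kernel.
rewrite -[leRHS](RintegralT_cst k2b); apply: ae_le_Rintegral => //.
- apply: (@bounded_mfun_Rintegral _ _ _ _ _ _ _ k (cst a)
    (fun a' b' => expected_payoff u (t1 a') (s2 b')) (@measurable_cst _ _ _ _ _ _)).
  exact: bounded_expected_payoff.
- exact: bounded_mfun_cst.
- apply: aeW => a'.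
  have : t1 a' setT = 1%E by exact: prob_kernel.
  by move: (t1 a' : {measure set _ -> \bar R}); apply: probability_ind.
Qed.

(** The deviation is the Dirac mass at [x]. One null set of types serves all actions, although these
    may be uncountably many. *)
Lemma best_reply_pure : best_reply ->
  \forall a \ae m, forall x,
    \int[k a]_b \int[s2 b]_y u x y <= interim_value a.
Proof.
apply: filterS => a br x; apply: le_trans (br (dirac x)).
rewrite le_eqVlt; apply/orP; left; apply/eqP; apply: eq_Rintegral => b _.
rewrite /expected_payoff [RHS]/Rintegral integral_dirac//=.
  by rewrite indicT mul1r.
apply/measurable_EFinP.
have := @bounded_mfun_Rintegral _ _ _ _ _ _ _ s2 (cst b) u
  (measurable_cst b) bu.
by case.
Qed.

End best_reply.

(** * Bounds on interim values and uniqueness of the value *)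

Section zero_sum.
Context {R : realType} {d1 d2 e1 e2} {T1 : measurableType d1}
  {T2 : measurableType d2} {X1 : measurableType e1} {X2 : measurableType e2}.
Variables (m1 : probability T1 R) (m2 : probability T2 R)
  (k1 : R.-pker T1 ~> T2) (k2 : R.-pker T2 ~> T1)
  (u1 : X1 -> X2 -> R) (u2 : X2 -> X1 -> R).
Hypothesis u12 : forall x y, u1 x y + u2 y x = 0.
Hypothesis bu1 : bounded_mfun (fun q => u1 q.1 q.2).
(** The common prior enters here only in this form: both kernels disintegrate the same joint law. *)
Hypothesis balanced : forall f : T1 -> T2 -> R,
  bounded_mfun (fun q => f q.1 q.2) ->
  \int[m1]_a \int[k1 a]_b f a b = \int[m2]_b \int[k2 b]_a f a b.

Lemma zero_sum_bounded : bounded_mfun (fun q => u2 q.1 q.2).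
Proof.
have -> : (fun q => u2 q.1 q.2) = (fun q => - u1 q.2 q.1).
  by apply/funext => q; have := u12 q.2 q.1; lra.
apply: bounded_mfunN.
exact: (bounded_mfun_comp (@measurable_swap _ _ _ _) bu1).
Qed.
Let bu2 := zero_sum_bounded.

Lemma expected_payoff_opp (mu : {measure set X1 -> \bar R})
    (nu : {measure set X2 -> \bar R}) : mu setT = 1%E -> nu setT = 1%E ->
  expected_payoff u2 nu mu = - expected_payoff u1 mu nu.
Proof.
move=> mu1 nu1; rewrite /expected_payoff bounded_Fubini//.
rewrite -(bounded_RintegralN mu1); last exact: bounded_mfun_Rintegral_cst.
apply: eq_Rintegral => x _; rewrite -(bounded_RintegralN nu1).
  by apply: eq_Rintegral => y _; have := u12 x y; lra.
exact: (bounded_mfun_comp (pair1_measurable x) bu1).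
Qed.

Lemma kernel_payoff_opp (s1 : R.-pker T1 ~> X1) (s2 : R.-pker T2 ~> X2) a b :
  expected_payoff u2 (s2 b) (s1 a) = - expected_payoff u1 (s1 a) (s2 b).
Proof. by apply: expected_payoff_opp; exact: prob_kernel. Qed.

Let bW (s1 : R.-pker T1 ~> X1) (s2 : R.-pker T2 ~> X2) :
  bounded_mfun (fun q => expected_payoff u1 (s1 q.1) (s2 q.2)).
Proof. exact: bounded_expected_payoff. Qed.

Lemma mean_interim_value_opp (s1 : R.-pker T1 ~> X1) (s2 : R.-pker T2 ~> X2) :
  \int[m2]_b interim_value u2 k2 s2 s1 b =
  - \int[m1]_a interim_value u1 k1 s1 s2 a.
Proof.
have m21 : m2 setT = 1%E by exact: probability_setT.
rewrite (balanced (bW s1 s2)) -(bounded_RintegralN m21); last first.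
  apply: (@bounded_mfun_Rintegral _ _ _ _ _ _ _ k2 id
    (fun b a => expected_payoff u1 (s1 a) (s2 b))) => //.
  exact: (bounded_mfun_comp (@measurable_swap _ _ _ _) (bW s1 s2)).
apply: eq_Rintegral => b _; have k2b : k2 b setT = 1%E by exact: prob_kernel.
rewrite -(bounded_RintegralN k2b); last first.
  exact: (bounded_mfun_comp (pair2_measurable b) (bW s1 s2)).
by apply: eq_Rintegral => a _; exact: kernel_payoff_opp.
Qed.

(* The payoff J(a, b) of the introduction. *)
Definition crossed_payoff (s1 : R.-pker T1 ~> X1) (s2 : R.-pker T2 ~> X2) a b :=
  \int[k2 b]_a' \int[k1 a]_b' expected_payoff u1 (s1 a') (s2 b').

(** Given [a] and [b] the two draws are independent, so Fubini exchanges them whatever the prior. *)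
Lemma crossed_payoff_opp (s1 : R.-pker T1 ~> X1) (s2 : R.-pker T2 ~> X2) a b :
  \int[k1 a]_b' \int[k2 b]_a' expected_payoff u2 (s2 b') (s1 a') =
  - crossed_payoff s1 s2 a b.
Proof.
have k1a : k1 a setT = 1%E by exact: prob_kernel.
have k2b : k2 b setT = 1%E by exact: prob_kernel.
rewrite /crossed_payoff bounded_Fubini//; last first.
  exact: (bounded_expected_payoff s2 s1 bu2).
rewrite -(bounded_RintegralN k2b); last exact: bounded_mfun_Rintegral_cst.
apply: eq_Rintegral => a' _; rewrite -(bounded_RintegralN k1a).
  by apply: eq_Rintegral => b' _; exact: kernel_payoff_opp.
exact: (bounded_mfun_comp (pair1_measurable a') (bW s1 s2)).
Qed.

(** The crossed payoff pairs the two opponents' strategies, [t1] and [s2]: it averages deviations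
    against [s2] and also deviations against [t1]. Equal profiles give the interim values of one
    equilibrium; different ones compare two equilibria. *)
Lemma crossed_payoff_bounds (s1 t1 : R.-pker T1 ~> X1)
    (s2 t2 : R.-pker T2 ~> X2) :
  best_reply m1 u1 k1 s1 s2 -> best_reply m2 u2 k2 t2 t1 ->
  \forall a \ae m1, \forall b \ae m2,
    - interim_value u2 k2 t2 t1 b <= crossed_payoff t1 s2 a b
    <= interim_value u1 k1 s1 s2 a.
Proof.
move=> /(best_reply_mean bu1 k2) br1 /(best_reply_mean bu2 k1) br2.
apply: filterS br1 => a br1; apply: filterS br2 => b br2.
by rewrite br1 andbT lerNl -crossed_payoff_opp; exact: br2.
Qed.

(** The crossed payoff drops out of the two bounds. Averaging the lower one over [b] turns it into
    the first player's mean under [t1] and [t2]. *)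
Lemma interim_value_ge (s1 t1 : R.-pker T1 ~> X1) (s2 t2 : R.-pker T2 ~> X2) :
  best_reply m1 u1 k1 s1 s2 -> best_reply m2 u2 k2 t2 t1 ->
  \forall a \ae m1, \int[m1]_a interim_value u1 k1 t1 t2 a <=
    interim_value u1 k1 s1 s2 a.
Proof.
move=> br1 br2; apply: filterS (crossed_payoff_bounds br1 br2) => a.
have m21 : m2 setT = 1%E by exact: probability_setT.
rewrite -[leLHS]opprK -mean_interim_value_opp => br.
rewrite -(bounded_RintegralN m21); last exact: bounded_interim_value.
rewrite -[leRHS](RintegralT_cst m21); apply: ae_le_Rintegral => //.
- exact/bounded_mfunN/bounded_interim_value.
- exact: bounded_mfun_cst.
- by apply: filterS br => b /andP[]; exact: le_trans.
Qed.

Lemma equilibrium_value_le (s1 t1 : R.-pker T1 ~> X1)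
    (s2 t2 : R.-pker T2 ~> X2) :
  best_reply m1 u1 k1 s1 s2 -> best_reply m2 u2 k2 t2 t1 ->
  \int[m1]_a interim_value u1 k1 t1 t2 a <=
  \int[m1]_a interim_value u1 k1 s1 s2 a.
Proof.
move=> br1 br2; have m11 : m1 setT = 1%E by exact: probability_setT.
rewrite -[leLHS](RintegralT_cst m11); apply: ae_le_Rintegral => //.
- exact: bounded_mfun_cst.
- exact: bounded_interim_value.
- exact: interim_value_ge br1 br2.
Qed.

(** With equal profiles the interim value is almost everywhere at least its own mean, hence equal to
    it. *)
Lemma equilibrium_interim_value (s1 : R.-pker T1 ~> X1)
    (s2 : R.-pker T2 ~> X2) :
  best_reply m1 u1 k1 s1 s2 -> best_reply m2 u2 k2 s2 s1 ->
  \forall a \ae m1, interim_value u1 k1 s1 s2 a =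
    \int[m1]_a interim_value u1 k1 s1 s2 a.
Proof.
move=> br1 br2; have m11 : m1 setT = 1%E by exact: probability_setT.
have bV := bounded_interim_value k1 s1 s2 bu1.
have := ae_eq_of_ae_le m11 (bounded_mfun_cst _) bV (interim_value_ge br1 br2).
by rewrite RintegralT_cst// => /(_ erefl); apply: filterS => a <-.
Qed.

End zero_sum.

(** * Bounded completeness *)

Lemma bounded_mfun_measurable_eq (R : realType) d (T : measurableType d)
    (f : T -> R) c : bounded_mfun f -> measurable [set x | f x = c].
Proof.
move=> [mf _]; have := mf measurableT _ (measurable_set1 c).
by rewrite setTI.
Qed.

(** Used as a payoff, this indicator has as [expected_payoff] the probability that independent play
    misses [v]. *)
Lemma bounded_disagreement (R : realType) d d' (X : measurableType d)
    (X' : measurableType d') (u : X -> X' -> R) v :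
  bounded_mfun (fun q => u q.1 q.2) ->
  bounded_mfun (fun q : X * X' => (u q.1 q.2 != v)%:R : R).
Proof.
move=> bu.
have := @bounded_mfun_indic R _ _ _ (measurableC (bounded_mfun_measurable_eq v bu)).
congr bounded_mfun; apply/funext => q; rewrite indicE; congr (nat_of_bool _)%:R.
by apply/idP/idP => [/set_mem /= /eqP|/eqP ?]; [|apply/mem_set].
Qed.

Lemma bounded_complete_ae (R : realType) d d' (T : measurableType d)
    (T' : measurableType d') (m : {measure set T -> \bar R})
    (k : R.-pker T ~> T') (g : T' -> R) c :
  bounded_complete m k -> bounded_mfun g ->
  (\forall a \ae m, \int[k a]_b g b = c) ->
  \forall a \ae m, \forall b \ae k a, g b = c.
Proof.
move=> km bg gc; have bgc := bounded_mfunB bg (bounded_mfun_cst c).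
have := km (fun b => g b - c) bgc.1 bgc.2; move=> /(_ _) kgc.
have {kgc} : \forall a \ae m, k a [set b | g b - c = 0] = 1%E.
  apply: kgc; apply: filterS gc => a gac.
  have ka : k a setT = 1%E by exact: prob_kernel.
  by rewrite (bounded_RintegralB ka bg (bounded_mfun_cst c)) gac
    RintegralT_cst// subrr.
apply: filterS => a; have ka : k a setT = 1%E by exact: prob_kernel.
have mA : measurable [set b | g b - c = 0] := bounded_mfun_measurable_eq 0 bgc.
move=> kA; exists (~` [set b | g b - c = 0]); split.
- exact: measurableC.
- move: (k a : {measure set T' -> \bar R}) ka kA; apply: probability_ind => P PA.
  by apply: (etrans (probability_setC P mA)); rewrite (PA : P _ = 1%E) subee.
- by move=> b /= gb gb0; apply: gb; apply/eqP; rewrite -subr_eq0 gb0.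
Qed.

Section complete_balanced.
Context {R : realType} {d1 d2} {T1 : measurableType d1} {T2 : measurableType d2}.
Variables (m1 : probability T1 R) (m2 : probability T2 R)
  (k1 : R.-pker T1 ~> T2) (k2 : R.-pker T2 ~> T1).
Hypothesis balanced : forall f : T1 -> T2 -> R,
  bounded_mfun (fun q => f q.1 q.2) ->
  \int[m1]_a \int[k1 a]_b f a b = \int[m2]_b \int[k2 b]_a f a b.

(** Completeness gives [g = c] almost surely under the beliefs of almost every type, hence under the
    joint law, whose second marginal is [m2]. *)
Lemma complete_balanced_ae (g : T2 -> R) c :
  bounded_complete m1 k1 -> bounded_mfun g ->
  (\forall a \ae m1, \int[k1 a]_b g b = c) -> \forall b \ae m2, g b = c.
Proof.
move=> km bg /(bounded_complete_ae km bg) gc.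
have m11 : m1 setT = 1%E by exact: probability_setT.
have m21 : m2 setT = 1%E by exact: probability_setT.
pose f (b : T2) : R := \1_(~` [set b | g b = c]) b.
have fE b : f b = 0 <-> g b = c.
  rewrite /f indicE in_setC; split; last by move=> gb; rewrite mem_set.
  by case: (boolP (_ \in _)) => [/set_mem//|_ /eqP]; rewrite oner_eq0.
have bf : bounded_mfun f.
  exact/bounded_mfun_indic/measurableC/bounded_mfun_measurable_eq.
have bf2 : bounded_mfun (fun q : T1 * T2 => f q.2).
  exact: (bounded_mfun_comp measurable_snd bf).
have f_ge0 b : 0 <= f b by rewrite /f indicE ler0n.
suff : \int[m2]_b f b = 0.
  by move=> /(Rintegral_eq0_ae m21 bf f_ge0); apply: filterS => b /fE.
(* A dummy integration over [k2 b] produces an integral over the joint law, which [balanced] then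
   reads from the other side. *)
have -> : \int[m2]_b f b = \int[m2]_b \int[k2 b]_a f b.
  apply: eq_Rintegral => b _.
  by rewrite RintegralT_cst//; exact: prob_kernel.
rewrite -(balanced bf2) -[RHS](RintegralT_cst m11); apply: ae_eq_Rintegral => //.
- exact: (@bounded_mfun_Rintegral _ _ _ _ _ _ _ k1 id _ (@measurable_id _ _ _) bf2).
- exact: bounded_mfun_cst.
- apply: filterS gc => a gc; have k1a : k1 a setT = 1%E by exact: prob_kernel.
  rewrite -[RHS](RintegralT_cst k1a); apply: ae_eq_Rintegral => //.
    exact: bounded_mfun_cst.
  by apply: filterS gc => b /fE.
Qed.

End complete_balanced.

(** * From interim values to realized payoffs *)

Section identifiable.
Context {R : realType} {d1 d2 e1 e2} {T1 : measurableType d1}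
  {T2 : measurableType d2} {X1 : measurableType e1} {X2 : measurableType e2}.
Variables (m1 : probability T1 R) (m2 : probability T2 R)
  (k1 : R.-pker T1 ~> T2) (k2 : R.-pker T2 ~> T1)
  (u1 : X1 -> X2 -> R) (u2 : X2 -> X1 -> R)
  (s1 : R.-pker T1 ~> X1) (s2 : R.-pker T2 ~> X2).
Hypothesis u12 : forall x y, u1 x y + u2 y x = 0.
Hypothesis bu1 : bounded_mfun (fun q => u1 q.1 q.2).
Hypothesis balanced : forall f : T1 -> T2 -> R,
  bounded_mfun (fun q => f q.1 q.2) ->
  \int[m1]_a \int[k1 a]_b f a b = \int[m2]_b \int[k2 b]_a f a b.
Hypotheses (br1 : best_reply m1 u1 k1 s1 s2) (br2 : best_reply m2 u2 k2 s2 s1).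
Hypotheses (complete1 : bounded_complete m1 k1)
  (complete2 : bounded_complete m2 k2).

Let v := \int[m1]_a interim_value u1 k1 s1 s2 a.
Let m11 : m1 setT = 1%E. Proof. exact: probability_setT. Qed.
Let m21 : m2 setT = 1%E. Proof. exact: probability_setT. Qed.
Let bu2 : bounded_mfun (fun q => u2 q.1 q.2).
Proof. exact: zero_sum_bounded u12 bu1. Qed.
Let u21 y x : u2 y x + u1 x y = 0. Proof. by rewrite addrC. Qed.
Let balanced' (f : T2 -> T1 -> R) : bounded_mfun (fun q => f q.1 q.2) ->
  \int[m2]_b \int[k2 b]_a f b a = \int[m1]_a \int[k1 a]_b f b a.
Proof.
move=> bf; rewrite (balanced (f := fun a b => f b a))//.
exact: (bounded_mfun_comp (@measurable_swap _ _ _ _) bf).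
Qed.

Let bW : bounded_mfun (fun q => expected_payoff u1 (s1 q.1) (s2 q.2)).
Proof. exact: bounded_expected_payoff. Qed.

Lemma crossed_payoff_value :
  \forall a \ae m1, \forall b \ae m2, crossed_payoff k1 k2 u1 s1 s2 a b = v.
Proof.
have V1 := equilibrium_interim_value u12 bu1 balanced br1 br2.
have V2 := equilibrium_interim_value u21 bu2 balanced' br2 br1.
have J := crossed_payoff_bounds u12 bu1 br1 br2.
apply: filterS2 J V1 => a + V1a; apply: filterS2 V2 => b V2b.
rewrite V1a V2b (mean_interim_value_opp u12 bu1 balanced) opprK -/v.
by move=> /le_anti.
Qed.

(** For fixed [a], the crossed payoff is the mean under [k2 b] of a function of [a'] alone, so
    completeness of [k2] makes that function constant. The quantifiers are then exchanged because
    the sequel fixes [a'] and varies [a]. *)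
Lemma interim_payoff_other_type :
  \forall a' \ae m1, \forall a \ae m1,
    \int[k1 a]_b expected_payoff u1 (s1 a') (s2 b) = v.
Proof.
have bI : bounded_mfun (fun q : T1 * T1 =>
    \int[k1 q.1]_b expected_payoff u1 (s1 q.2) (s2 b)).
  apply: (@bounded_mfun_Rintegral _ _ _ _ _ _ _ k1 fst
    (fun (q : T1 * T1) b => expected_payoff u1 (s1 q.2) (s2 b)) measurable_fst).
  apply: (bounded_expected_payoff _ _ bu1 (h1 := fun q : T1 * T1 * T2 => q.1.2)) => //.
  exact: measurableT_comp measurable_snd measurable_fst.
apply: ae_swap => //; first exact: bounded_mfun_measurable_eq.
apply: filterS crossed_payoff_value => a Ja.
apply: (complete_balanced_ae balanced' complete2); last exact: Ja.
exact: (bounded_mfun_comp (pair1_measurable a) bI).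
Qed.

Let r x b := \int[s2 b]_y u1 x y.

Let br : bounded_mfun (fun q => r q.1 q.2).
Proof.
apply: (@bounded_mfun_Rintegral _ _ _ _ _ _ _ s2 snd
  (fun (q : X1 * T2) y => u1 q.1 y) measurable_snd).
apply: (bounded_mfun_comp _ bu1 (h := fun q : X1 * T2 * X2 => (q.1.1, q.2))).
apply: measurable_fun_pair => //.
exact: measurableT_comp measurable_fst measurable_fst.
Qed.

Lemma realized_action_payoff :
  \forall a' \ae m1, \forall x \ae s1 a', \forall b \ae m2, r x b = v.
Proof.
have bq : bounded_mfun (fun q : T1 * X1 => \int[k1 q.1]_b r q.2 b).
  apply: (@bounded_mfun_Rintegral _ _ _ _ _ _ _ k1 fst
    (fun (q : T1 * X1) b => r q.2 b) measurable_fst).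
  apply: (bounded_mfun_comp _ br (h := fun q : T1 * X1 * T2 => (q.1.2, q.2))).
  apply: measurable_fun_pair => //.
  exact: measurableT_comp measurable_snd measurable_fst.
have br_x x : bounded_mfun (r x) := bounded_mfun_comp (pair1_measurable x) br.
have V1 := equilibrium_interim_value u12 bu1 balanced br1 br2.
have P1 := best_reply_pure bu1 br1.
apply: filterS interim_payoff_other_type => a' Ia'.
have s1a' : s1 a' setT = 1%E by exact: prob_kernel.
have : \forall a \ae m1, \forall x \ae s1 a', \int[k1 a]_b r x b = v.
  (* No action earns more than [v], while the actions of [a'] earn [v] on average; hence almost all
     of them earn exactly [v]. *)
  have Q : \forall a \ae m1, forall x, \int[k1 a]_b r x b <= v.
    by apply: filterS2 V1 P1 => a; rewrite -/v => <-.
  apply: filterS2 Ia' Q => a Ia' Q.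
  have k1a : k1 a setT = 1%E by exact: prob_kernel.
  apply: (ae_eq_of_ae_le s1a').
  - exact: (bounded_mfun_comp (pair1_measurable a) bq).
  - exact: (bounded_mfun_cst v).
  - exact: aeW.
  - by rewrite RintegralT_cst// bounded_Fubini.
(* Completeness of [k1] concerns one function of [b] and almost all [a], so the action [x] has to be
   fixed first. *)
move=> /(ae_swap m11 s1a') => /(_ (bounded_mfun_measurable_eq v bq)).
by apply: filterS => x; apply: (complete_balanced_ae balanced complete1).
Qed.

(** For a fixed realized action [x], the function [u1 x] has mean [v] under [s2 b] for almost every
    [b]; completeness of [s2] makes it equal to [v] at almost every action of [b]. *)
Lemma identifiable_ex_post : bounded_complete m2 s2 ->
  \forall a \ae m1, \forall b \ae m2,
    expected_payoff (fun x y => (u1 x y != v)%:R : R) (s1 a) (s2 b) = 0.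
Proof.
move=> ident; pose e x y : R := (u1 x y != v)%:R.
have be : bounded_mfun (fun q => e q.1 q.2) := bounded_disagreement v bu1.
have bD : bounded_mfun (fun q : X1 * T2 => \int[s2 q.2]_y e q.1 y).
  apply: (@bounded_mfun_Rintegral _ _ _ _ _ _ _ s2 snd
    (fun (q : X1 * T2) y => e q.1 y) measurable_snd).
  apply: (bounded_mfun_comp _ be (h := fun q : X1 * T2 * X2 => (q.1.1, q.2))).
  apply: measurable_fun_pair => //.
  exact: measurableT_comp measurable_fst measurable_fst.
apply: filterS realized_action_payoff => a ra.
have s1a : s1 a setT = 1%E by exact: prob_kernel.
have : \forall x \ae s1 a, \forall b \ae m2, \int[s2 b]_y e x y = 0.
  apply: filterS ra => x rx.
  have bux : bounded_mfun (u1 x) := bounded_mfun_comp (pair1_measurable x) bu1.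
  have bex : bounded_mfun (e x) := bounded_mfun_comp (pair1_measurable x) be.
  apply: filterS (bounded_complete_ae ident bux rx) => b ub.
  have s2b : s2 b setT = 1%E by exact: prob_kernel.
  rewrite -[RHS](RintegralT_cst s2b); apply: ae_eq_Rintegral => //.
    exact: bounded_mfun_cst.
  by apply: filterS ub => y; rewrite /e => ->; rewrite eqxx.
move=> /(ae_swap s1a m21) => /(_ (bounded_mfun_measurable_eq 0 bD)).
apply: filterS => b eb; rewrite -[RHS](RintegralT_cst s1a).
apply: ae_eq_Rintegral => //; last exact: bounded_mfun_cst.
exact: (bounded_mfun_comp (pair2_measurable b) bD).
Qed.

End identifiable.

(** * Bayesian games *)

Section game.
Context {R : realType} (G : bayesian_game R).

Let m := marginal G.

Lemma prior_disintegration i (f : types_of G i -> types_of G (~~ i) -> R) :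
  bounded_mfun (fun q : borel (types_of G i) * borel (types_of G (~~ i)) =>
    f q.1 q.2) ->
  \int[prior G]_s f (type_coord (types_of G) i s)
                    (type_coord (types_of G) (~~ i) s) =
  \int[m i]_t \int[cond G i t]_t' f t t'.
Proof.
move=> bf; apply: (@bounded_disintegration R _ _ _ _ _ _ (prior G)
  (type_coord (types_of G) i) (type_coord (types_of G) (~~ i)) (m i) (cond G i)
  f _ _ _ bf).
- exact: (@measurable_type_coord R (types_of G)).
- exact: (@measurable_type_coord R (types_of G)).
- by move=> C D mC mD; exact: (@condE R G i C D mC mD).
Qed.

Lemma prior_balanced
    (f : borel (types_of G true) -> borel (types_of G false) -> R) :
  bounded_mfun (fun q => f q.1 q.2) ->
  \int[m true]_a \int[cond G true a]_b f a b =
  \int[m false]_b \int[cond G false b]_a f a b.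
Proof.
move=> bf; rewrite -(prior_disintegration (i := true) bf).
rewrite -(prior_disintegration (i := false) (f := fun b a => f a b))//.
exact: (bounded_mfun_comp (@measurable_swap _ _ _ _) bf).
Qed.

Lemma bounded_payoff i : bounded_mfun
  (fun q : actions_of G i * actions_of G (~~ i) => payoff G i q.1 q.2).
Proof.
split; first exact: payoff_measurable.
by have [M uM] := payoff_bounded G; exists M => q.
Qed.

Lemma ex_ante_payoffE (tau : strategy_profile G) i :
  ex_ante_payoff tau i =
  \int[m i]_t interim_value (payoff G i) (cond G i) (tau i) (tau (~~ i)) t.
Proof.
rewrite /ex_ante_payoff (prior_disintegration
  (f := fun t t' => mixed_payoff (tau i t) (tau (~~ i) t')))//.
exact: (bounded_expected_payoff _ _ (@bounded_payoff i)).
Qed.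

Lemma bayes_nash_best_reply (tau : strategy_profile G) i : bayes_nash tau ->
  best_reply (m i) (payoff G i) (cond G i) (tau i) (tau (~~ i)).
Proof. by move=> /(_ i). Qed.

(** Absolute continuity enters here: the exceptional set has null sections, so it is null for the
    product of the marginals and therefore for the prior. *)
Lemma prior_ae (P : borel (types_of G true) * borel (types_of G false) -> Prop) :
  measurable [set s | P s] ->
  (\forall a \ae m true, \forall b \ae m false, P (a, b)) ->
  \forall s \ae prior G, P s.
Proof.
move=> mP aeP; exists (~` [set s | P s]); split => //.
  exact: measurableC.
have /null_content_dominatesP := @prior_ac R G; apply; first exact: measurableC.
have mA : measurable (~` [set s | P s]) := measurableC mP.
transitivity (\int[m true]_a m false (xsection (~` [set s | P s]) a))%E => //.
rewrite (ae_eq_integral (cst 0%E)).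
- by rewrite integral0.
- exact: measurableT.
- exact: measurable_fun_xsection.
- exact: measurable_cst.
- apply: filterS aeP => a aeP _; apply: measure_negligible.
    exact: measurable_xsection.
  apply: negligibleS aeP => b; rewrite /xsection /= => /set_mem.
  by [].
Qed.

Lemma ex_ante_payoff_opp (tau : strategy_profile G) :
  ex_ante_payoff tau false = - ex_ante_payoff tau true.
Proof.
rewrite !ex_ante_payoffE.
exact: (mean_interim_value_opp (@payoff_zero_sum _ G) (@bounded_payoff true)
  prior_balanced).
Qed.

End game.

(** * The ex-post property *)

Section ex_post.
Context {R : realType} (G : bayesian_game R) (sigma : strategy_profile G).
Hypothesis types_complete :
  forall i : bool, bounded_complete (marginal G i) (cond G i).
Hypothesis sigma_equilibrium : bayes_nash sigma.

Let v := ex_ante_payoff sigma true.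

Let disagreement (x : actions_of G true) (y : actions_of G false) : R :=
  (payoff G true x y != v)%:R.

Lemma disagreement_null :
  identifiable (sigma true) \/ identifiable (sigma false) ->
  \forall a \ae marginal G true, \forall b \ae marginal G false,
    expected_payoff disagreement (sigma true a) (sigma false b) = 0.
Proof.
have br1 := bayes_nash_best_reply true sigma_equilibrium.
have br2 := bayes_nash_best_reply false sigma_equilibrium.
have be : bounded_mfun (fun q => disagreement q.1 q.2).
  exact: bounded_disagreement (bounded_payoff G true).
move=> [ident1|ident2]; last first.
  have := identifiable_ex_post (@payoff_zero_sum _ G) (@bounded_payoff R G true)
    (@prior_balanced _ G) br1 br2 (@types_complete true) (@types_complete false) ident2.
  rewrite -(ex_ante_payoffE sigma true).
  exact.
(* When A's strategy is the identifiable one, the players exchange roles: the result comes with [b]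
   quantified first and with value [- v], and missing [- v] for B is missing [v] for A. *)
have m11 : marginal G true setT = 1%E by exact: probability_setT.
have m21 : marginal G false setT = 1%E by exact: probability_setT.
apply: ae_swap => //.
  apply: bounded_mfun_measurable_eq.
  exact: (bounded_mfun_comp (@measurable_swap _ _ _ _)
    (bounded_expected_payoff (sigma true) (sigma false) be
      measurable_fst measurable_snd)).
have payoff_zero_sum' y x : payoff G false y x + payoff G true x y = 0.
  by rewrite addrC payoff_zero_sum.
have prior_balanced' (f : borel (types_of G false) -> borel (types_of G true) -> R) :
    bounded_mfun (fun q => f q.1 q.2) ->
    \int[marginal G false]_b \int[cond G false b]_a f b a =
    \int[marginal G true]_a \int[cond G true a]_b f b a.
  move=> bf; rewrite (prior_balanced (f := fun a b => f b a))//.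
  exact: (bounded_mfun_comp (@measurable_swap _ _ _ _) bf).
have := identifiable_ex_post payoff_zero_sum' (@bounded_payoff R G false)
    prior_balanced' br2 br1 (@types_complete false) (@types_complete true) ident1.
rewrite -(ex_ante_payoffE sigma false) ex_ante_payoff_opp -/v.
apply: filterS => b; apply: filterS => a <-.
rewrite /expected_payoff bounded_Fubini//; try exact: prob_kernel.
apply: eq_Rintegral => y _; apply: eq_Rintegral => x _.
rewrite /disagreement; congr (nat_of_bool (~~ _))%:R.
by rewrite -(addr0_eq (payoff_zero_sum x y)) eqr_opp.
Qed.

Lemma action_law_disagreement :
  identifiable (sigma true) \/ identifiable (sigma false) ->
  action_law sigma [set x | payoff G true x.1 x.2 != v] = 0%E.
Proof.
move=> /disagreement_null null.
have be : bounded_mfun (fun q => disagreement q.1 q.2).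
  exact: bounded_disagreement (bounded_payoff G true).
pose E := [set x : actions_of G true * actions_of G false |
  payoff G true x.1 x.2 != v].
have mE : measurable E.
  have := measurableC (bounded_mfun_measurable_eq v (bounded_payoff G true)).
  by congr measurable; apply/seteqP; split => q /= /eqP.
pose e s := expected_payoff disagreement (sigma true s.1) (sigma false s.2).
have be2 : bounded_mfun (fun s => e s).
  exact: bounded_expected_payoff.
(* Given the types, actions are independent, so the mass of [E] is an expected disagreement, already
   known to vanish for almost all independent types. *)
have eE s : (sigma true s.1 \x sigma false s.2)%E E = (e s)%:E.
  have s1 : sigma true s.1 setT = 1%E by exact: prob_kernel.
  have s2 : sigma false s.2 setT = 1%E by exact: prob_kernel.
  rewrite /e /expected_payoff (EFin_bounded_Rintegral s1); last first.
    exact: bounded_mfun_Rintegral_cst.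
  apply: eq_integral => x _; rewrite (EFin_bounded_Rintegral s2); last first.
    exact: (bounded_mfun_comp (pair1_measurable x) be).
  rewrite /= -[xsection E x]setIT -integral_indic//; last exact: measurable_xsection.
  apply: eq_integral => y _; rewrite indicE /disagreement; congr (nat_of_bool _)%:R%:E.
  by apply/idP/idP => [/set_mem/set_mem//|xyE]; do 2 apply/mem_set.
rewrite /action_law.
under eq_integral do rewrite eE.
have F1 : prior G setT = 1%E by exact: probability_setT.
rewrite -(EFin_bounded_Rintegral F1)//; congr EFin.
rewrite -[RHS](RintegralT_cst F1); apply: ae_eq_Rintegral => //.
  exact: bounded_mfun_cst.
apply: prior_ae => //.
exact: bounded_mfun_measurable_eq.
Qed.

End ex_post.

Lemma ex_ante_payoff_le (R : realType) (G : bayesian_game R)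
    (sigma tau : strategy_profile G) :
  bayes_nash sigma -> bayes_nash tau ->
  ex_ante_payoff tau true <= ex_ante_payoff sigma true.
Proof.
move=> sN tN; rewrite !ex_ante_payoffE.
exact: (equilibrium_value_le (@payoff_zero_sum _ G) (@bounded_payoff R G true)
  (@prior_balanced _ G) (bayes_nash_best_reply true sN)
  (bayes_nash_best_reply false tN)).
Qed.

Theorem theorem1 (R : realType) (G : bayesian_game R)
  (types_complete : forall i : bool, bounded_complete (marginal G i) (cond G i))
  (sigma : strategy_profile G)
  (sigma_equilibrium : bayes_nash sigma)
  (sigma_identifiable :
    identifiable (sigma true) \/ identifiable (sigma false))
  (U : bool -> R)
  (U_equilibrium_payoff : equilibrium_payoff G U) :
  ex_post sigma U.
Proof.
have [tau tau_equilibrium tauU] := U_equilibrium_payoff.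
have Utrue : U true = ex_ante_payoff sigma true.
  (* The comparison of equilibria is applied in both directions. *)
  by rewrite -tauU; apply/le_anti; rewrite !ex_ante_payoff_le.
have Ufalse : U false = - ex_ante_payoff sigma true.
  by rewrite -Utrue -!tauU ex_ante_payoff_opp.
(* One null set serves both players, since their payoffs are opposite and so are the values of
   [U]. *)
move=> i; exists [set x | payoff G true x.1 x.2 != ex_ante_payoff sigma true].
split.
- have := measurableC (bounded_mfun_measurable_eq (ex_ante_payoff sigma true)
    (bounded_payoff G true)).
  by congr measurable; apply/seteqP; split => q /= /eqP.
- exact: action_law_disagreement.
- move=> x /= nx; apply/eqP => px; apply: nx; case: i => /=.
    by rewrite Utrue.
  rewrite Ufalse -px; apply/eqP; rewrite -addr_eq0 addrC; apply/eqP.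
  exact: payoff_zero_sum.
Qed.
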